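(* Let $P(z)=\sum_{i=0}^{n}a_{i}z^{i}\in\mathbb{R}[z]$ be a nonzero real polynomial all of whose complex zeros lie in the open left half plane $\operatorname{Re} z<0$. Then for every integer $r$ with $0\le r<4$ such that the polynomial $$P_{r}(z)=\sum_{\substack{j\equiv r \pmod 4\\ 0\le j\le n}}a_{j}z^{j}$$ is not identically zero, every complex zero $z$ of $P_r$ lies on the $4$ radial rays given by $\operatorname{Im} z^{4}=0$ and $\operatorname{Re} z^{4}\le 0$. *)

(* Defs.v *)
From mathcomp Require Import all_boot all_order all_algebra.
From mathcomp Require Import complex.
From mathcomp Require Import reals.

Set Implicit Arguments.
Unset Strict Implicit.
Unset Printing Implicit Defensive.

Import GRing.Theory Num.Theory.
Local Open Scope ring_scope.

(* The exponents are kept: the coefficient of 'X^j stays at 'X^j, with no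
   substitution of the variable. *)
Definition multisection (R : nzRingType) (m r : nat) (P : {poly R}) : {poly R} :=
  \sum_(0 <= j < size P | j == r %[mod m]) P`_j *: 'X^j.

Definition complex_root (R : realType) (P : {poly R}) (z : R[i]) : Prop :=
  root (map_poly (real_complex R) P) z.

(* Main.v *)
Require Import Defs.
From mathcomp Require Import all_boot all_order all_algebra.
From mathcomp Require Import complex.
From mathcomp Require Import reals.
From mathcomp Require Import ring.

Import Order.TTheory GRing.Theory Num.Theory.
Local Open Scope ring_scope.

(** Write P(z) = E(z^2) + z O(z^2).  The sections of P modulo 4 are, up to a
monomial factor and the substitution z^4 for the variable, the even and odd
parts of E and of O.  So it suffices to iterate twice a Hermite-Biehler
statement (bisection_root_le0): if a real polynomial Q has all its zeros in the
closed half plane Re a <= 0, then every nonzero one among its even and odd parts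
has only real nonpositive zeros.  These zeros lie again in the closed left half
plane, hence the iteration.  The closed half plane is the right hypothesis: the
even or odd part of a stable polynomial is only known to have zeros w <= 0, so
w = 0 has to be allowed at the second step.

The Hermite-Biehler statement comes from a comparison of norms.  Let w be a zero
of the even or odd part that is not a nonpositive real number, and let z be its
square root with Re z > 0.  The vanishing of that part says Q(z) = -Q(-z) or
Q(z) = Q(-z); in both cases |Q(z)| = |Q(-z)|, which is |Q(- conj z)| since Q is
real.  But - conj z is the mirror image of z in the imaginary axis, hence closer
to each zero of Q than z, or as close when that zero is imaginary
(norm_reflect_leif).  Equality of the products over all zeros thus forces
every zero of Q to be imaginary.  Then conjugation acts on the zeros as negation,
so that Q is an even or an odd polynomial (reflect_imaginary_rooted).  If w is a
zero of its part of the same parity as Q, then z is a zero of Q with Re z > 0, a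
contradiction; the other part is identically zero. *)

Definition bisection {R : nzRingType} (s : bool) (Q : {poly R}) : {poly R} :=
  if s then odd_poly Q else even_poly Q.

Lemma coef_bisection {R : nzRingType} (s : bool) (Q : {poly R}) (i : nat) :
  (bisection s Q)`_i = Q`_(i.*2 + s).
Proof.
by case: s; rewrite /= ?coef_odd_poly ?coef_even_poly ?addn1 ?addn0.
Qed.

Lemma bisection0 (R : nzRingType) (s : bool) : bisection s (0 : {poly R}) = 0.
Proof. by apply/polyP=> i; rewrite coef_bisection !coef0. Qed.

Lemma map_bisection (R S : nzRingType) (f : {additive R -> S}) (s : bool)
    (Q : {poly R}) :
  map_poly f (bisection s Q) = bisection s (map_poly f Q).
Proof. by apply/polyP=> i; rewrite !(coef_map, coef_bisection). Qed.

(** Treating the two parities by one sign lets the analytic argument below run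
once, instead of once for the even part and once for the odd part. *)
Lemma bisection_comp (R : comNzRingType) (s : bool) (Q : {poly R}) :
  (bisection s Q \Po 'X^2) * 'X^s *+ 2 = Q + (-1) ^+ s *: (Q \Po - 'X).
Proof.
have E : Q \Po - 'X = (even_poly Q \Po 'X^2) - (odd_poly Q \Po 'X^2) * 'X.
  rewrite -{1}[Q]poly_even_odd comp_polyD comp_polyM comp_polyX -!comp_polyA.
  by rewrite comp_Xn_poly sqrrN mulrN.
rewrite E -{2}[Q]poly_even_odd; case: s => /=.
  by rewrite expr1 scaleN1r; ring.
by rewrite !expr0 scale1r; ring.
Qed.

Lemma coef_multisection (R : nzRingType) (m r : nat) (P : {poly R}) (i : nat) :
  (multisection m r P)`_i = if i == r %[mod m] then P`_i else 0.
Proof.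
rewrite /multisection big_mkord coef_sum.
under eq_bigr do rewrite coefZ coefXn.
have [ltis|leis] := ltnP i (size P).
  rewrite big_mkcond (bigD1 (Ordinal ltis)) //= eqxx mulr1 big1 ?addr0 //.
  move=> j; rewrite -val_eqE /= eq_sym => /negPf ->.
  by rewrite mulr0 if_same.
rewrite big1 => [|j _]; first by rewrite nth_default ?if_same.
by rewrite gtn_eqF ?mulr0 // (leq_trans (ltn_ord j)).
Qed.

(** The binary digits s and t of the residue r say which half to keep first in
P, then in the result. *)
Lemma multisection4E (R : nzRingType) (s t : bool) (P : {poly R}) :
  multisection 4 (s + t.*2) P =
    'X^(s + t.*2) * (bisection t (bisection s P) \Po 'X^4).
Proof.
apply/polyP=> i; rewrite coef_multisection coefXnM coef_comp_poly_Xn //.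
have lt4 : (s + t.*2 < 4)%N by case: s; case: t.
rewrite (modn_small lt4) !coef_bisection.
case: ltnP => [ltir|leri].
  by rewrite modn_small ?(ltn_trans ltir) // ltn_eqF.
rewrite -(modn_small lt4) -/(i == s + t.*2 %[mod 4]) eqn_mod_dvd ?modn_small //.
case: ifP => // /dvdnP[k Dk]; rewrite Dk mulnK //; congr (P`_ _).
rewrite -(subnK leri) Dk doubleD -!muln2 -mulnA /=.
by rewrite -addnA [(t * 2 + s)%N]addnC.
Qed.

Section HalfPlane.

Variable C : numClosedFieldType.
Implicit Types (Q : {poly C}) (z a : C).

(** A point a of the closed left half plane is on the same side as the mirror
image of z in the imaginary axis, which is the perpendicular bisector of these
two points; quantitatively, the squared distances differ by 4 Re a Re z. *)
Lemma norm_reflect_leif z a : 0 < 'Re z -> 'Re a <= 0 ->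
  `|- z^* - a| <= `|z - a| ?= iff ('Re a == 0).
Proof.
move=> z_gt0 a_le0.
have D : `|z - a| ^+ 2 - `|- z^* - a| ^+ 2 = - ('Re a) * 'Re z * 4.
  rewrite !normCK !ReE !(rmorphB, rmorphN) /= conjCK.
  by field.
split; first by rewrite -ler_sqr ?nnegrE // -subr_ge0 D !mulr_ge0 ?oppr_ge0 // ltW.
rewrite eq_sym -(eqrXn2 (n := 2)) // -subr_eq0 D !mulf_eq0 oppr_eq0.
by rewrite (gt_eqF z_gt0) pnatr_eq0 !orbF.
Qed.

Lemma conj_horner Q z : Q \is a polyOver Num.real -> Q.[z]^* = Q.[z^*].
Proof.
move=> Q_real; rewrite -horner_map map_poly_id // => x.
by move/(allP Q_real)/CrealP.
Qed.

(** Conjugating the coefficients fixes Q and turns each factor X - a into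
X - conj a, which is X + a because a is imaginary; substituting - X turns X - a
into - (X + a). *)
Lemma reflect_imaginary_rooted (lc : C) (rs : seq C) :
    lc \is Num.real -> {in rs, forall a, 'Re a = 0} ->
  let Q := lc *: \prod_(a <- rs) ('X - a%:P) in
  Q \is a polyOver Num.real -> Q \Po - 'X = (-1) ^+ size rs *: Q.
Proof.
move=> lc_real rs_im Q Q_real.
have QJ : Q = map_poly Num.conj Q.
  by rewrite map_poly_id // => x; move/(allP Q_real)/CrealP.
rewrite [in RHS]QJ /Q linearZ /= map_polyZ /= (CrealP lc_real).
rewrite scalerA mulrC -scalerA; congr (_ *: _).
rewrite rmorph_prod rmorph_prod /=.
elim: rs rs_im {Q Q_real QJ} => [|a rs IHrs] rs_im.
  by rewrite !big_nil expr0 scale1r.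
rewrite !big_cons IHrs => [|b b_rs]; last by rewrite rs_im // inE b_rs orbT.
rewrite comp_polyB comp_polyX comp_polyC rmorphB /= map_polyX map_polyC /=.
have -> : a^* = - a.
  have /eqP := rs_im a (mem_head _ _).
  by rewrite ReE mulf_eq0 invr_eq0 pnatr_eq0 orbF addrC addr_eq0 => /eqP.
rewrite exprS mulN1r -scalerAr polyCN opprK -opprD.
by rewrite mulNr scaleNr scalerN scalerAr.
Qed.

(** Hermite-Biehler, without interlacing and for the closed half plane. *)
Lemma bisection_root_le0 Q (s : bool) w :
    Q \is a polyOver Num.real -> (forall a, root Q a -> 'Re a <= 0) ->
  bisection s Q != 0 -> root (bisection s Q) w -> w <= 0.
Proof.
move=> Q_real Q_stable B_neq0 B_root.
have [z [zw z_ge0]] : exists z : C, z ^+ 2 = w /\ 0 <= 'Re z.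
  have /orP[] := Creal_Re (sqrtC w) => z0; [exists (sqrtC w) | exists (- sqrtC w)];
  by rewrite ?sqrrN sqrtCK ?raddfN ?oppr_ge0.
(* If z is imaginary, then w is minus the square of a real number. *)
rewrite le_eqVlt in z_ge0; have {z_ge0}[/eqP z0|z_gt0] := orP z_ge0.
  rewrite -zw [z]Crect -z0 add0r exprMn sqrCi mulN1r oppr_le0.
  by rewrite -realEsqr Creal_Im.
have Qz_neq0 : Q.[z] != 0.
  by apply/negP=> /Q_stable/(lt_le_trans z_gt0); rewrite ltxx.
have QN : Q.[z] = - ((-1) ^+ s * Q.[- z]).
  apply/eqP; rewrite -addr_eq0; have := congr1 (horner^~ z) (bisection_comp _ s Q).
  rewrite hornerMn hornerM horner_comp hornerXn zw (rootP B_root) mul0r mul0rn.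
  by rewrite hornerD hornerZ horner_comp hornerN hornerX => <-.
have Q_neq0 : Q != 0 by apply: contraNneq Qz_neq0 => ->; rewrite horner0.
have [rs DQ] := closed_field_poly_normal Q.
have rootsQ a : a \in rs -> 'Re a <= 0.
  move=> a_rs; apply: Q_stable; rewrite DQ rootZ ?lead_coef_eq0 //.
  by rewrite root_prod_XsubC.
have hQ u : Q.[u] = lead_coef Q * \prod_(i < size rs) (u - rs`_i).
  rewrite {1}DQ hornerZ horner_prod (big_nth 0) big_mkord.
  by under eq_bigr do rewrite hornerXsubC.
(* The products of the distances agree, so all the inequalities between the
   distances are equalities. *)
have rs_im : {in rs, forall a, 'Re a = 0}.
  have := @leif_pprod _ 'I_(size rs) predT (fun i => 'Re rs`_i == 0)
    (fun i => `|- z^* - rs`_i|) (fun i => `|z - rs`_i|).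
  case=> [//|i _|_].
    by apply: norm_reflect_leif => //; apply/rootsQ/mem_nth.
  rewrite -!normr_prod normr_eq0.
  have lc_gt0 : 0 < `|lead_coef Q| by rewrite normr_gt0 lead_coef_eq0.
  have -> : `|\prod_(i < size rs) (- z^* - rs`_i)| =
            `|\prod_(i < size rs) (z - rs`_i)|.
    apply: (mulfI (lt0r_neq0 lc_gt0)); rewrite -!normrM -!hQ QN -[- z^*]rmorphN.
    by rewrite -conj_horner // norm_conjC normrN normrMsign.
  rewrite eqxx => /esym/orP[prod0|/forallP im a a_rs].
    by case/eqP: Qz_neq0; rewrite hQ (eqP prod0) mulr0.
  have i_lt : (index a rs < size rs)%N by rewrite index_mem.
  by have /eqP := im (Ordinal i_lt); rewrite /= nth_index.
have lc_real : lead_coef Q \is Num.real by apply: (polyOverP Q_real).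
have sym : Q \Po - 'X = (-1) ^+ size rs *: Q.
  by rewrite DQ; apply: reflect_imaginary_rooted => //; rewrite -DQ.
(* Either Q has the parity of s, and z would be a zero of Q in the open right
   half plane, or it has the other parity, and its s-part is zero. *)
have [par|par] := eqVneq (odd (size rs)) s.
  have : Q.[z] + Q.[z] == 0.
    rewrite {1}QN; have := congr1 (horner^~ z) sym.
    rewrite horner_comp hornerN hornerX hornerZ => ->.
    by rewrite -(signr_odd _ (size rs)) par signrMK addNr.
  by rewrite -mulr2n mulrn_eq0 (negPf Qz_neq0).
case/eqP: B_neq0; apply/eqP.
rewrite -(@comp_poly_eq0 _ _ 'X^2) ?size_polyXn //.
have := bisection_comp _ s Q.
rewrite sym scalerA -(signr_odd _ (size rs)) -signr_addb.
have -> : s (+) odd (size rs) by case: (s) (odd _) par => [] [].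
rewrite expr1 scaleN1r subrr => /eqP.
by rewrite -scaler_nat scaler_eq0 pnatr_eq0 mulf_eq0 expf_eq0 polyX_eq0 andbF orbF.
Qed.

End HalfPlane.

Theorem theorem2 (R : realType) (P : {poly R}) (P_neq0 : P != 0)
    (P_stable : forall z : R[i], complex_root P z -> complex.Re z < 0) :
  forall r : nat, (r < 4)%N -> multisection 4 r P != 0 ->
  forall z : R[i], complex_root (multisection 4 r P) z ->
    complex.Im (z ^+ 4) = 0 /\ complex.Re (z ^+ 4) <= 0.
Proof.
move=> r r_lt4 Pr_neq0 z Pr_root.
suff : z ^+ 4 <= 0 by rewrite lecE /= => /andP[/eqP <- ->].
have [s [t Dr]] : exists s t : bool, r = (s + t.*2)%N.
  by exists (odd r), (odd r./2); case: r r_lt4 {Pr_neq0 Pr_root} => [|[|[|[|]]]].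
subst r; move: Pr_neq0 Pr_root; rewrite /complex_root multisection4E.
rewrite mulf_eq0 negb_or => /andP[_ B_neq0].
rewrite rmorphM /= rootM map_polyXn => /orP[|].
  rewrite rootE hornerXn expf_eq0 => /andP[_ /eqP ->].
  by rewrite expr0n.
set Q := map_poly (real_complex R) P.
rewrite map_comp_poly map_polyXn !map_bisection -/Q rootE horner_comp hornerXn => B_root.
have Q_real : Q \is a polyOver Num.real.
  apply/polyOverP=> i; rewrite coef_map.
  by rewrite realE !lecE /= eqxx -realE num_real.
have B2_neq0 : bisection t (bisection s Q) != 0.
  rewrite -!map_bisection map_poly_eq0; apply: contraNneq B_neq0 => ->.
  by rewrite comp_poly0.
have B1_neq0 : bisection s Q != 0.
  by apply: contraNneq B2_neq0 => ->; rewrite bisection0.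
apply: (bisection_root_le0 _ _ t _ _ _ B2_neq0 B_root).
  by apply/polyOverP=> i; rewrite coef_bisection; apply: (polyOverP Q_real).
move=> a a_root.
have a_le0 : a <= 0.
  apply: (bisection_root_le0 _ Q s a Q_real _ B1_neq0 a_root) => b b_root.
  by rewrite -complexRe lecR ltW // P_stable.
by rewrite (Creal_ReP _ _) ?ler0_real.
Qed.
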